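(* Let $G$ and $H$ be (possibly infinite) graphs. (i) If $v\mapsto H_v$ is a region representation of $G$ over $H$, then $(H,\mathcal V)$ with $V_h=\{v\in V(G): h\in V(H_v)\}$ for $h\in V(H)$ is a graph-decomposition of $G$ into cliques, for which the family $(H_v)_{v\in V(G)}$ is a valid choice of co-parts. (ii) If $(H,\mathcal V)$ is a graph-decomposition of $G$ into cliques and $(H_v)_{v\in V(G)}$ is a valid choice of co-parts, then $v\mapsto H_v$ is a region representation of $G$ over $H$.
   Context: Graphs are simple. A region of $H$ is a nonempty connected subgraph of $H$. A region representation of $G$ over $H$ is a map $v\mapsto H_v$ assigning to each vertex $v$ of $G$ a region $H_v$ of $H$ such that, for distinct vertices $u,v$, $uv$ is an edge of $G$ if and only if $H_u\cap H_v$ is nonempty. A graph-decomposition of $G$ is a pair $(H,\mathcal V)$ of a graph $H$ and a family $\mathcal V=(V_h)_{h\in V(H)}$ of vertex-subsets of $G$ (bags) such that $G=\bigcup_{h\in V(H)}G[V_h]$ and, for every vertex $v$ of $G$, the subgraph $H[W_v]$ of $H$ induced on $W_v=\{h\in V(H): v\in V_h\}$ is connected. A valid choice of co-parts is a family $(H_v)_{v\in V(G)}$ in which each $H_v$ is a connected spanning subgraph of $H[W_v]$. The graph-decomposition is into cliques if every bag $V_h$ is a clique of $G$, i.e. induces a complete subgraph (the empty set is allowed). *)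

(* Defs.v *)
From Stdlib Require Import Relations.

Set Implicit Arguments.

Record graph := Graph {
  vertex :> Type;
  adj : vertex -> vertex -> Prop;
  adj_sym : forall x y, adj x y -> adj y x;
  adj_irrefl : forall x, ~ adj x x
}.
Arguments adj {g} x y.

(* Subgraphs are compared extensionally, by [same_subgraph], rather than by
   Leibniz equality of the records. *)
Record subgraph (H : graph) := Subgraph {
  verts : H -> Prop;
  edges : H -> H -> Prop;
  edges_sym : forall x y, edges x y -> edges y x;
  edges_adj : forall x y, edges x y -> adj x y;
  edges_verts : forall x y, edges x y -> verts x
}.

Definition is_subgraph (H : graph) (K L : subgraph H) : Prop :=
  (forall x, verts K x -> verts L x) /\
  (forall x y, edges K x y -> edges L x y).

Definition same_subgraph (H : graph) (K L : subgraph H) : Prop :=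
  is_subgraph K L /\ is_subgraph L K.

Definition spanning_subgraph (H : graph) (K L : subgraph H) : Prop :=
  is_subgraph K L /\ (forall x, verts L x -> verts K x).

Definition nonempty (H : graph) (K : subgraph H) : Prop :=
  exists x, verts K x.

(* The empty subgraph is connected under this convention; nonemptiness is
   required separately in [region]. *)
Definition connected (H : graph) (K : subgraph H) : Prop :=
  forall x y, verts K x -> verts K y -> clos_refl_trans H (edges K) x y.

Definition complete (H : graph) (K : subgraph H) : Prop :=
  forall x y, verts K x -> verts K y -> x <> y -> edges K x y.

Definition whole (H : graph) : subgraph H.
Proof.
refine (@Subgraph H (fun _ => True) (fun x y => adj x y) _ _ _).
- exact (adj_sym H).
- exact (fun x y e => e).
- exact (fun _ _ _ => I).
Defined.

Definition induced (H : graph) (W : H -> Prop) : subgraph H.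
Proof.
refine (@Subgraph H W (fun x y => W x /\ W y /\ adj x y) _ _ _).
- intros x y [Wx [Wy e]]; exact (conj Wy (conj Wx (adj_sym H _ _ e))).
- intros x y [_ [_ e]]; exact e.
- intros x y [Wx _]; exact Wx.
Defined.

Definition intersection (H : graph) (K L : subgraph H) : subgraph H.
Proof.
refine (@Subgraph H (fun x => verts K x /\ verts L x)
                    (fun x y => edges K x y /\ edges L x y) _ _ _).
- intros x y [eK eL]; exact (conj (edges_sym K _ _ eK) (edges_sym L _ _ eL)).
- intros x y [eK _]; exact (edges_adj K _ _ eK).
- intros x y [eK eL]; exact (conj (edges_verts K _ _ eK) (edges_verts L _ _ eL)).
Defined.

Definition union (H : graph) (I : Type) (K : I -> subgraph H) : subgraph H.
Proof.
refine (@Subgraph H (fun x => exists i, verts (K i) x)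
                    (fun x y => exists i, edges (K i) x y) _ _ _).
- intros x y [i e]; exact (ex_intro _ i (edges_sym (K i) _ _ e)).
- intros x y [i e]; exact (edges_adj (K i) _ _ e).
- intros x y [i e]; exact (ex_intro _ i (edges_verts (K i) _ _ e)).
Defined.

Definition region (H : graph) (K : subgraph H) : Prop :=
  nonempty K /\ connected K.

Definition region_representation {G H : graph} (R : G -> subgraph H) : Prop :=
  (forall v, region (R v)) /\
  (forall u v, u <> v -> (adj u v <-> nonempty (intersection (R u) (R v)))).

(* [B h] is the bag V_h; [copart B v] is the set W_v. *)
Definition copart {G H : graph} (B : H -> G -> Prop) (v : G) : H -> Prop :=
  fun h => B h v.

Definition graph_decomposition {G H : graph} (B : H -> G -> Prop) : Prop :=
  same_subgraph (whole G) (union (fun h => induced G (B h))) /\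
  (forall v, connected (induced H (copart B v))).

Definition into_cliques {G H : graph} (B : H -> G -> Prop) : Prop :=
  forall h, complete (induced G (B h)).

Definition valid_coparts {G H : graph} (B : H -> G -> Prop)
    (R : G -> subgraph H) : Prop :=
  forall v, connected (R v) /\
            spanning_subgraph (R v) (induced H (copart B v)).

Definition bags_of {G H : graph} (R : G -> subgraph H) : H -> G -> Prop :=
  fun h v => verts (R v) h.

(* Main.v *)
From Stdlib Require Import Relations Setoid.
Require Import Defs.

(** A family of bags and a family of regions are two readings of one incidence
    relation between vertices of [G] and vertices of [H]: the node [h] lies in
    the region of [v] exactly when [v] lies in the bag of [h].  Under this
    duality, [copart_meet] says that two regions intersect exactly when the two
    vertices share a bag, so the conditions translate one by one.  In a
    representation, vertices sharing a bag are adjacent, which is what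
    being into cliques asks; conversely, that every region is nonempty and that
    the regions of adjacent vertices meet says exactly that the bags cover the
    vertices and the edges of [G].  Connectedness passes from a spanning
    subgraph to the induced one ([connected_spanning]), so the regions
    witness that the co-parts are connected. *)

Lemma clos_refl_trans_mono (A : Type) (R S : relation A) :
  (forall x y, R x y -> S x y) ->
  forall x y, clos_refl_trans A R x y -> clos_refl_trans A S x y.
Proof.
  intros RS x y Rxy.
  induction Rxy as [x y Rxy | x | x y z _ Sxy _ Syz].
  - apply rt_step, RS, Rxy.
  - apply rt_refl.
  - exact (rt_trans _ _ _ _ _ Sxy Syz).
Qed.

Lemma connected_spanning (H : graph) (K L : subgraph H) :
  spanning_subgraph K L -> connected K -> connected L.
Proof.
  intros [[_ KL] LK] cK x y Lx Ly.
  exact (clos_refl_trans_mono _ _ _ KL x y (cK x y (LK x Lx) (LK y Ly))).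
Qed.

Lemma spanning_induced (H : graph) (K : subgraph H) :
  spanning_subgraph K (induced H (verts K)).
Proof.
  split; [split |]; simpl; auto.
  intros x y e; repeat split.
  - exact (edges_verts K _ _ e).
  - exact (edges_verts K _ _ (edges_sym K _ _ e)).
  - exact (edges_adj K _ _ e).
Qed.

(** Inclusion in the whole graph is automatic for a union of induced subgraphs,
    so only the covering of vertices and edges carries information. *)
Lemma same_whole_union_induced (G : graph) (I : Type) (B : I -> G -> Prop) :
  same_subgraph (whole G) (union (fun i => induced G (B i))) <->
  (forall v, exists i, B i v) /\
  (forall u v : G, adj u v -> exists i, B i u /\ B i v).
Proof.
  split.
  - intros [[V E] _]; split.
    + intros v; exact (V v Logic.I).
    + intros u v e; destruct (E u v e) as [i [Bu [Bv _]]].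
      exists i; split; assumption.
  - intros [V E]; split; split; simpl.
    + intros v _; apply V.
    + intros u v e; destruct (E u v e) as [i [Bu Bv]].
      exists i; auto.
    + trivial.
    + intros u v [i [_ [_ e]]]; exact e.
Qed.

Lemma valid_coparts_verts (G H : graph) (B : H -> G -> Prop)
    (R : G -> subgraph H) :
  valid_coparts B R -> forall v h, verts (R v) h <-> B h v.
Proof.
  intros VR v h; destruct (VR v) as [_ [[sub _] span]].
  split; [apply sub | apply span].
Qed.

Lemma copart_meet (G H : graph) (B : H -> G -> Prop) (R : G -> subgraph H) :
  valid_coparts B R -> forall u v,
  nonempty (intersection (R u) (R v)) <-> exists h, B h u /\ B h v.
Proof.
  intros VR u v; pose proof (valid_coparts_verts _ _ _ _ VR) as RB.
  split; intros [h [hu hv]]; exists h; split; apply RB; assumption.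
Qed.

Lemma valid_coparts_bags_of (G H : graph) (R : G -> subgraph H) :
  (forall v, connected (R v)) -> valid_coparts (bags_of R) R.
Proof.
  intros cR v; split; [apply cR | exact (spanning_induced H (R v))].
Qed.

Lemma region_representation_decomposition (G H : graph)
    (R : G -> subgraph H) :
  region_representation R ->
  graph_decomposition (bags_of R) /\
  into_cliques (bags_of R) /\
  valid_coparts (bags_of R) R.
Proof.
  intros [reg rep].
  assert (VR : valid_coparts (bags_of R) R)
    by (apply valid_coparts_bags_of; intros v; apply reg).
  pose proof (copart_meet _ _ _ _ VR) as meet.
  split; [split | split]; [| | | exact VR].
  - apply same_whole_union_induced; split.
    + intros v; exact (proj1 (reg v)).
    + intros u v e; apply meet, rep; [| exact e].
      intros ->; exact (adj_irrefl G v e).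
  - intros v; destruct (VR v) as [cv sv].
    exact (connected_spanning H _ _ sv cv).
  - intros h u v hu hv ne; split; [exact hu | split; [exact hv |]].
    apply rep; [exact ne |].
    apply meet; exists h; split; assumption.
Qed.

Lemma decomposition_region_representation (G H : graph)
    (B : H -> G -> Prop) (R : G -> subgraph H) :
  graph_decomposition B -> into_cliques B -> valid_coparts B R ->
  region_representation R.
Proof.
  intros [cover _] cliques VR.
  apply same_whole_union_induced in cover; destruct cover as [coverV coverE].
  split.
  - intros v; split; [| apply VR].
    destruct (coverV v) as [h Bhv].
    exists h; apply (valid_coparts_verts _ _ _ _ VR), Bhv.
  - intros u v ne; rewrite (copart_meet _ _ _ _ VR); split.
    + apply coverE.
    + intros [h [hu hv]]; apply (cliques h u v hu hv ne).
Qed.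

Theorem theorem2 (G H : graph) :
  (forall R : G -> subgraph H,
     region_representation R ->
     graph_decomposition (bags_of R) /\
     into_cliques (bags_of R) /\
     valid_coparts (bags_of R) R) /\
  (forall (B : H -> G -> Prop) (R : G -> subgraph H),
     graph_decomposition B ->
     into_cliques B ->
     valid_coparts B R ->
     region_representation R).
Proof.
  split.
  - apply region_representation_decomposition.
  - apply decomposition_region_representation.
Qed.
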